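(* Let $n\ge 3$ and $r\ge 2$ be integers, let $a,b\in\mathbb{Z}_r$, and consider the braid diagram $\sigma_1^n$ ($\sigma_1\in B_2$) endowed with the $r$-coloring whose top segments are colored, from left to right, $a$ and $b$ (so that, for $1\le i\le n$, the arc emerging from the $i$-th crossing, counted from the top, has color $(i+1)b-ia$). Perform the type I Reidemeister move and then the $n-1$ successive type III Reidemeister moves of the Teneva transformation (described in the context), which take the bottom left arc of the braid over each crossing above it until the top of the braid is reached, consistently recoloring the diagram after each move. Then: (1) the first type III Reidemeister move introduces color $(n+2)b-(n+1)a$ on the left-hand side of the diagram; (2) for $2\le i\le n-1$, the $i$-th type III Reidemeister move removes color $(n+1-i)b-(n-i)a$ from the right-hand side of the diagram and introduces color $(n+1+i)b-(n+i)a$ on the left-hand side of the diagram.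
   Context: An $r$-coloring (Fox coloring) of a (tangle, braid or link) diagram assigns an element of $\mathbb{Z}_r=\mathbb{Z}/r\mathbb{Z}$ (a color) to each arc so that at each crossing the sum of the colors of the two under-arcs minus twice the color of the over-arc is $0$ mod $r$. After a Reidemeister move performed in a disc, the consistent recoloring is the unique $r$-coloring of the new diagram that agrees with the old one outside the disc. All colors are read mod $r$. Convention for the braid: strands run from top to bottom, and at each crossing of $\sigma_1^n$ the strand coming from the upper right passes over to the lower left, while the strand coming from the upper left passes under and emerges at the lower right. If the strands entering a crossing are colored $x$ (left) and $y$ (right), those leaving it are colored $y$ (left) and $2y-x$ (right). Thus the bottom segments of $\sigma_1^n$ are colored $nb-(n-1)a$ (left) and $(n+1)b-na$ (right). Teneva transformation: let $h$ be the over-arc at the $n$-th (bottom) crossing, i.e. the arc ending at the bottom left of the braid, of color $nb-(n-1)a$. The type I move puts a kink in this strand: the strand leaving crossing $n-1$ at the lower right now descends, turns to the right and back up, and then runs horizontally from right to left, just below crossing $n-1$, passing over itself and then over the strand leaving crossing $n-1$ at the lower left, before going down to the bottom left endpoint; the left strand, after passing under, goes to the bottom right endpoint. The horizontal piece is the arc $h$. For $1\le i\le n-1$, the $i$-th type III move slides $h$ from just below crossing $n-i$ to just above it, over that crossing; after this move $h$ passes over the two strands entering crossing $n-i$ from above. ''Introduces color $c$ on the left-hand side'' by the $i$-th type III move means that the new diagram has a new arc, on the left, running between $h$ and crossing $n-i$ (the left strand entering crossing $n-i$ from under $h$), and this arc has color $c$. ''Removes color $c$ from the right-hand side'' means that the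 arc that emerged at the lower right of crossing $n-i$ and ended under $h$ before the move, which had color $c$, is no longer present after the move. *)

(* Defs.v *)
From mathcomp Require Import all_boot all_algebra.
From mathcomp Require Import zify ring.

Set Implicit Arguments.
Unset Strict Implicit.
Unset Printing Implicit Defensive.

Import GRing.Theory.

(* Tangle diagrams are cut by horizontal lines into slices, read from top to
   bottom; each slice contains one crossing, one local maximum or one local
   minimum, all its other strands being vertical.  Positions are numbered from
   the left, starting at 0.
   [Cross true k]  : the strands at k, k+1 cross, and the one coming from the
                     upper right passes over to the lower left;
   [Cross false k] : the mirror image, the upper left strand passes over;
   [Max k]         : a maximum, its two legs appear at k, k+1;
   [Min k]         : a minimum, the strands at k, k+1 are joined. *)
Inductive slice := Cross of bool & nat | Max of nat | Min of nat.

Notation sigma k := (Cross true k).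

Definition over_top e k := if e then k.+1 else k.
Definition over_bot e k := if e then k else k.+1.
Definition under_top e k := if e then k else k.+1.
Definition under_bot e k := if e then k.+1 else k.

Definition width_below s m :=
  match s with Cross _ _ => m | Max _ => m.+2 | Min _ => m.-2 end.

Definition fits s m :=
  match s with Cross _ k => k.+1 < m | Max k => k <= m | Min k => k.+1 < m end.

Record diagram := Diagram { top_width : nat; slices : seq slice }.

(* Level l is the horizontal line just above slice l (counted from 0); level
   [size (slices D)] is the bottom. *)
Definition width D l :=
  foldl (fun m s => width_below s m) (top_width D) (take l (slices D)).

Definition well_formed D :=
  forall l s, onth (slices D) l = Some s -> fits s (width D l).

(* (level, position) *)
Definition point := (nat * nat)%type.

Definition on D (x : point) := (x.1 <= size (slices D)) && (x.2 < width D x.1).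

(* The strand at position p above the slice leaves it at position q, without
   having passed under another strand. *)
Definition through s p q :=
  match s with
  | Cross e k => if p == over_top e k then q == over_bot e k
                 else (p != under_top e k) && (q == p)
  | Max k => q == (if p < k then p else p.+2)
  | Min k => p == (if q < k then q else q.+2)
  end.

(* Arcs run from one under-passage (or endpoint of the tangle) to the next:
   they are the classes of this relation. *)
Inductive same_arc D : point -> point -> Prop :=
| arc_refl x : on D x -> same_arc D x x
| arc_sym x y : same_arc D x y -> same_arc D y x
| arc_trans x y z : same_arc D x y -> same_arc D y z -> same_arc D x z
| arc_through l s p q : onth (slices D) l = Some s -> p < width D l ->
    through s p q -> same_arc D (l, p) (l.+1, q)
| arc_max l k : onth (slices D) l = Some (Max k) ->
    same_arc D (l.+1, k) (l.+1, k.+1)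
| arc_min l k : onth (slices D) l = Some (Min k) ->
    same_arc D (l, k) (l, k.+1).

(* A coloring of the arcs of D is given as a function on points, constant on
   each arc; its values outside the diagram are irrelevant. *)
Definition fox_coloring r D (c : point -> 'Z_r) :=
  (forall x y, same_arc D x y -> c x = c y) /\
  (forall l e k, onth (slices D) l = Some (Cross e k) ->
    c (l, under_top e k) + c (l.+1, under_bot e k)
      - c (l, over_top e k) *+ 2 = 0)%R.

(* A local modification: the slices [old], between [above] and [below], are
   replaced by [new]. *)
Record move := Move { strands : nat; above : seq slice; old : seq slice;
                      new : seq slice; below : seq slice }.

Definition source m := Diagram (strands m) (above m ++ old m ++ below m).
Definition target m := Diagram (strands m) (above m ++ new m ++ below m).

(* x and x' are the same point outside the region modified by m, in the
   diagrams before and after m.  It is enough to consider the levels above and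
   below that region: a strand which stands beside it is vertical and reaches
   these levels, within the same arc. *)
Definition outside m (x x' : point) :=
  [/\ on (source m) x, on (target m) x', x.2 = x'.2 &
      (x.1 <= size (above m) /\ x'.1 = x.1) \/
      (exists j, x.1 = size (above m) + size (old m) + j /\
                 x'.1 = size (above m) + size (new m) + j)].

Definition recolors r m (c c' : point -> 'Z_r) :=
  [/\ fox_coloring (source m) c, fox_coloring (target m) c' &
      forall x x', outside m x x' -> c' x' = c x].

(* The strand at position k gets a kink: it passes under itself, turns to the
   right and back up, then runs to the left over itself. *)
Definition reidemeister_I w k u v :=
  Move w u [::] [:: Max k.+1; sigma k; Min k.+1] v.

(* The strand which comes from the right passes over the two others; it is
   moved from below their crossing to above it. *)
Definition reidemeister_III w k u v :=
  Move w u [:: sigma k; sigma k.+1; sigma k]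
           [:: sigma k.+1; sigma k; sigma k.+1] v.

(* Planar isotopies which exchange the heights of a crossing and of a local
   extremum to its right; they are meant for j + 2 <= k. *)
Definition isotopy_max w j k u v :=
  Move w u [:: sigma j; Max k] [:: Max k; sigma j] v.
Definition isotopy_min w j k u v :=
  Move w u [:: Min k; sigma j] [:: sigma j; Min k] v.

Definition braid n := Diagram 2 (nseq n (sigma 0)).

(* Type I move, on the strand leaving crossing n-1 at the lower right.  The
   bottom crossing of the braid becomes the one where the kinked strand passes
   over the left strand; the isotopy then pushes the bottom of the kink below
   it, so that h passes over two strands in succession. *)
Definition teneva_I n :=
  reidemeister_I 2 1 (nseq n.-1 (sigma 0)) [:: sigma 0].
Definition teneva_I_isotopy n :=
  isotopy_min 2 0 2 (nseq n.-1 (sigma 0) ++ [:: Max 2; sigma 1]) [::].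

(* The i-th type III move: an isotopy first raises the top of the kink beside
   crossing n-i, then h is moved over that crossing. *)
Definition teneva_III_isotopy n i :=
  isotopy_max 2 0 2 (nseq (n.-1 - i) (sigma 0))
    ([:: sigma 1; sigma 0] ++ nseq i.-1 (sigma 1) ++ [:: Min 2]).
Definition teneva_III n i :=
  reidemeister_III 2 0 (nseq (n.-1 - i) (sigma 0) ++ [:: Max 2])
    (nseq i.-1 (sigma 1) ++ [:: Min 2]).

(* The moves follow one another. *)
Lemma teneva_I_source n : 0 < n -> source (teneva_I n) = braid n.
Proof.
case: n => [//|n] _; rewrite /source /braid /=; congr Diagram.
by rewrite -[RHS]/(nseq n.+1 (sigma 0)) -addn1 nseqD.
Qed.

Lemma teneva_I_isotopy_source n :
  source (teneva_I_isotopy n) = target (teneva_I n).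
Proof. by rewrite /source /target /= -catA. Qed.

Lemma teneva_III_isotopy_source1 n : 1 < n ->
  source (teneva_III_isotopy n 1) = target (teneva_I_isotopy n).
Proof.
move=> n1; rewrite /source /target; congr Diagram; rewrite /= subn1.
have -> : nseq n.-1 (sigma 0) = nseq n.-2 (sigma 0) ++ [:: sigma 0].
  by rewrite -[RHS](nseqD _ 1) addn1; case: n n1 => [|[|n]].
by rewrite -!catA.
Qed.

Lemma teneva_III_source n i :
  source (teneva_III n i) = target (teneva_III_isotopy n i).
Proof. by rewrite /source /target /= -catA. Qed.

Lemma teneva_III_isotopy_sourceS n i : 0 < i < n.-1 ->
  source (teneva_III_isotopy n i.+1) = target (teneva_III n i).
Proof.
move=> /andP[i0 ilt]; rewrite /source /target /=; congr Diagram.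
have -> : n.-1 - i = n.-1 - i.+1 + 1 by lia.
by rewrite nseqD -!catA; case: i i0 {ilt}.
Qed.

(* The successive colorings: cB of the braid, cI after the type I move,
   c 0 after the isotopy following it and, for 1 <= i <= n-1, c i after the
   i-th type III move, d i being the coloring just before it. *)
Record teneva_coloring n r (a b : 'Z_r) (cB cI : point -> 'Z_r)
    (d c : nat -> point -> 'Z_r) : Prop := {
  teneva_braid : fox_coloring (braid n) cB;
  teneva_top : cB (0, 0) = a /\ cB (0, 1) = b;
  teneva_recolors_I : recolors (teneva_I n) cB cI;
  teneva_recolors_I_isotopy : recolors (teneva_I_isotopy n) cI (c 0);
  teneva_recolors_III_isotopy i : 1 <= i <= n.-1 ->
    recolors (teneva_III_isotopy n i) (c i.-1) (d i);
  teneva_recolors_III i : 1 <= i <= n.-1 ->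
    recolors (teneva_III n i) (d i) (c i) }.

Lemma well_formed_cons m s w : fits s m ->
  well_formed (Diagram (width_below s m) w) -> well_formed (Diagram m (s :: w)).
Proof. by move=> ? wf [|l] t /=; [case=> <-|exact: wf]. Qed.

Lemma well_formed_nil m : well_formed (Diagram m [::]).
Proof. by move=> l s; rewrite onth0n. Qed.

Lemma well_formed_nseq m e k j w : k.+1 < m -> well_formed (Diagram m w) ->
  well_formed (Diagram m (nseq j (Cross e k) ++ w)).
Proof. by move=> km wf; elim: j => //= j IH; apply: well_formed_cons. Qed.

Local Ltac wf := rewrite /source /target /= -?catA;
  repeat first [exact: well_formed_nil | apply: well_formed_nseq => //
               | apply: well_formed_cons => //].

Lemma braid_well_formed n : well_formed (braid n).
Proof. by rewrite /braid -[nseq _ _]cats0; wf. Qed.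

Lemma teneva_I_well_formed n : well_formed (target (teneva_I n)).
Proof. wf. Qed.

Lemma teneva_I_isotopy_well_formed n :
  well_formed (target (teneva_I_isotopy n)).
Proof. wf. Qed.

Lemma teneva_III_well_formed n i :
  well_formed (source (teneva_III n i)) /\ well_formed (target (teneva_III n i)).
Proof. split; wf. Qed.

(* The data of [teneva_coloring] exist.  A coloring is described by a row of
   integers at each level, j standing for the color a + j (b - a). *)
Definition row_ok s (u v : seq nat) :=
  (forall p q, through s p q -> nth 0 u p = nth 0 v q) /\
  match s with
  | Cross e k => nth 0 u (under_top e k) + nth 0 v (under_bot e k)
                 = nth 0 u (over_top e k) * 2
  | Max k => nth 0 v k = nth 0 v k.+1
  | Min k => nth 0 u k = nth 0 u k.+1
  end.

Definition rows_ok w (R : nat -> seq nat) :=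
  forall l s, onth w l = Some s -> row_ok s (R l) (R l.+1).

Definition row_coloring r (a b : 'Z_r) (R : nat -> seq nat) (x : point) :=
  (a + (b - a) *+ nth 0 (R x.1) x.2)%R.

Lemma row_coloringP r (a b : 'Z_r) m w R :
  rows_ok w R -> fox_coloring (Diagram m w) (row_coloring a b R).
Proof.
move=> ok; split.
  move=> x y; elim=> //.
  - by move=> {}x {}y z _ -> _ ->.
  - by move=> l s p q ls _ pq; rewrite /row_coloring /= ((ok _ _ ls).1 _ _ pq).
  - by move=> l k ls; rewrite /row_coloring /= (ok _ _ ls).2.
  - by move=> l k ls; rewrite /row_coloring /= (ok _ _ ls).2.
move=> l e k ls; rewrite /row_coloring /=; have [_ E] := ok _ _ ls.
rewrite /=; move: (b - a)%R => t.
rewrite mulrnDl -mulrnA -E mulrnDr; ring.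
Qed.

Lemma rows_ok_cat w1 w2 R : rows_ok w1 R ->
  rows_ok w2 (fun l => R (size w1 + l)) -> rows_ok (w1 ++ w2) R.
Proof.
move=> ok1 ok2 l s; rewrite onth_cat; case: ltnP => hl; first exact: ok1.
by move/ok2; rewrite addnS subnKC.
Qed.

Lemma rows_ok_cons s w R : row_ok s (R 0) (R 1) ->
  rows_ok w (fun l => R l.+1) -> rows_ok (s :: w) R.
Proof. by move=> ok1 ok2 [|l] t /=; [case=> <-|exact: ok2]. Qed.

Lemma rows_ok_nil R : rows_ok [::] R.
Proof. by move=> l s; rewrite onth0n. Qed.

Lemma rows_ok_nseq k s R : (forall l, l < k -> row_ok s (R l) (R l.+1)) ->
  rows_ok (nseq k s) R.
Proof. by move=> ok l t; rewrite onth_nseq; case: ifP => // /ok ? [<-]. Qed.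

Lemma ok_sigma0 x y y' z t t' : y = y' -> t = t' -> x + z = y * 2 ->
  row_ok (sigma 0) (x :: y :: t) (y' :: z :: t').
Proof. by move=> <- <- h; split=> // -[|[|p]] [|[|q]] //= /eqP[->]. Qed.

Lemma ok_sigma1 u u' x y y' z t t' : u = u' -> y = y' -> t = t' ->
  x + z = y * 2 -> row_ok (sigma 1) (u :: x :: y :: t) (u' :: y' :: z :: t').
Proof.
by move=> <- <- <- h; split=> // -[|[|[|p]]] [|[|[|q]]] //= /eqP[->].
Qed.

Lemma ok_max x x' y y' z : x = x' -> y = y' ->
  row_ok (Max 2) [:: x; y] [:: x'; y'; z; z].
Proof.
by move=> <- <-; split=> // -[|[|p]] q /eqP -> //=; rewrite !nth_nil.
Qed.

Lemma ok_min x x' y y' z z' : x = x' -> y = y' -> z = z' ->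
  row_ok (Min 2) [:: x; y; z; z'] [:: x'; y'].
Proof.
by move=> <- <- <-; split=> // p [|[|q]] /eqP -> //=; rewrite !nth_nil.
Qed.

Definition row_braid l := [:: l; l.+1].
Definition row_I n l :=
  if l < n then row_braid l else if l <= n.+1 then [:: n.-1; n; n; n]
  else row_braid (l - 3).
Definition row_III n i l := let k := n.-1 - i in
  if l <= k then row_braid l
  else if l == k.+1 then [:: k; k.+1; n; n]
  else if l == k.+2 then [:: k; n; n + i; n]
  else if l <= k + 3 + i then [:: n; n + i.+1 + k + 3 - l; n + i + k + 3 - l; n]
  else row_braid n.
Definition row_pre n i l := let k := n.-1 - i in
  if l <= k then row_braid l
  else if l == k.+1 then [:: k; k.+1; n; n]
  else if l == k.+2 then [:: k.+1; k.+2; n; n]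
  else if l == k + 3 then [:: k.+1; n; (n + i).-1; n]
  else row_III n i l.

Local Ltac iff := repeat (case: ifP => ?; try lia).


Local Ltac oks := rewrite /row_I /row_pre /row_III /row_braid;
  repeat (case: ifP => ?; try lia);
  first [apply: ok_sigma0 | apply: ok_sigma1 | apply: ok_max | apply: ok_min];
  try lia; repeat congr (_ :: _); first [done | lia].
Local Ltac rows :=
  repeat lazymatch goal with
  | |- rows_ok [::] _ => exact: rows_ok_nil
  | |- rows_ok (_ :: _) _ => apply: rows_ok_cons
  | |- rows_ok (_ ++ _) _ => apply: rows_ok_cat
  | |- rows_ok (nseq _ _) _ => apply: rows_ok_nseq => ? ?
  end; rewrite ?size_cat ?size_nseq /=.

Lemma braid_ok n : rows_ok (nseq n (sigma 0)) row_braid.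
Proof. rows; oks. Qed.

Lemma row_I_ok n : 0 < n ->
  rows_ok (slices (target (teneva_I n))) (row_I n).
Proof. move=> n0; rewrite [slices _]/=; rows; oks. Qed.

Lemma row_III_ok n i : i < n ->
  rows_ok (nseq (n.-1 - i) (sigma 0) ++ [:: Max 2; sigma 1; sigma 0]
    ++ nseq i (sigma 1) ++ [:: Min 2]) (row_III n i).
Proof. move=> n0; rows; oks. Qed.

Lemma row_pre_ok n i : 0 < i < n ->
  rows_ok (slices (source (teneva_III n i))) (row_pre n i).
Proof. move=> n0; rewrite [slices _]/=; rows; oks. Qed.

Lemma recolors_rows r (a b : 'Z_r) m R R' :
  rows_ok (slices (source m)) R -> rows_ok (slices (target m)) R' ->
  (forall l, l <= size (above m) -> R' l = R l) ->
  (forall j, j <= size (below m) -> R' (size (above m) + size (new m) + j) =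
             R (size (above m) + size (old m) + j)) ->
  recolors m (row_coloring a b R) (row_coloring a b R').
Proof.
move=> ok ok' up down; split; [exact: row_coloringP..|].
move=> [l p] [l' p'] [/andP[/= hl _] /andP[/= hl' _] -> h].
rewrite /row_coloring /=.
case: h => [[lu ->]|[j [El El']]]; first by rewrite up.
rewrite El' El down //.
by move: hl'; rewrite El' !size_cat; lia.
Qed.

Local Ltac rws := rewrite ?(size_cat, size_nseq) /= ?(size_cat, size_nseq) /= /row_I /row_pre /row_III /row_braid => ?;
  repeat (case: ifP => ?; try lia); repeat congr (_ :: _); first [done | lia].

Lemma teneva_coloring_exists n r (a b : 'Z_r) : 1 < n ->
  exists cB cI d c, teneva_coloring n a b cB cI d c.
Proof.
move=> n1; exists (row_coloring a b row_braid), (row_coloring a b (row_I n)).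
exists (fun i => row_coloring a b (row_pre n i)).
exists (fun i => row_coloring a b (row_III n i)).
have okT i : 0 < i < n -> rows_ok (slices (target (teneva_III n i))) (row_III n i).
  move=> hi; have := @row_III_ok n i; rewrite /= -!catA /=.
  by case: i hi => // i hi; apply; lia.
split.
- by apply: row_coloringP; apply: braid_ok.
- by rewrite /row_coloring /=; split; ring.
- apply: recolors_rows.
  + by rewrite teneva_I_source; [exact: braid_ok|lia].
  + by apply: row_I_ok; lia.
  + by move=> l; rws.
  + by move=> j; rws.
- apply: recolors_rows.
  + by rewrite teneva_I_isotopy_source; apply: row_I_ok; lia.
  + by have := @row_III_ok n 0; rewrite subn0 /= -!catA; apply; lia.
  + by move=> l; rws.
  + by move=> j; rws.
- move=> i hi; apply: recolors_rows.
  + case: i hi => [//|[|i]] hi.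
      rewrite teneva_III_isotopy_source1 //.
      by have := @row_III_ok n 0; rewrite subn0 /= -!catA; apply; lia.
    by rewrite teneva_III_isotopy_sourceS; [apply: okT|]; lia.
  + by rewrite -teneva_III_source; apply: row_pre_ok; lia.
  + by move=> l; rws.
  + by move=> j; rws.
- move=> i hi; apply: recolors_rows.
  + by apply: row_pre_ok; lia.
  + by apply: okT; lia.
  + by move=> l; rws.
  + by move=> j; rws.
Qed.

(* At the crossing in slice l of D, the arc of x ... *)
Definition passes_over D l x := exists e k,
  onth (slices D) l = Some (Cross e k) /\ same_arc D (l, over_top e k) x.
Definition arrives_under D l x := exists e k,
  onth (slices D) l = Some (Cross e k) /\ same_arc D (l, under_top e k) x.
Definition emerges_under D l x := exists e k,
  onth (slices D) l = Some (Cross e k) /\ same_arc D (l.+1, under_bot e k) x.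
Definition enters_left D l x := exists e k,
  onth (slices D) l = Some (Cross e k) /\ same_arc D (l, k) x.
Definition leaves_right D l x := exists e k,
  onth (slices D) l = Some (Cross e k) /\ same_arc D (l.+1, k.+1) x.

(* An arc with a point outside the modified region persists after the move,
   and is not new. *)
Definition is_new m x := on (target m) x /\
  forall y y', outside m y y' -> ~ same_arc (target m) x y'.
Definition is_removed m x := on (source m) x /\
  forall y y', outside m y y' -> ~ same_arc (source m) x y.

Definition bottom_left D : point := (size (slices D), 0).

(* Crossing n-i of the braid is the first slice modified by [teneva_III n i];
   after the move, the two crossings of h come before it. *)
Definition crossing_before n i := size (above (teneva_III n i)).
Definition crossing_after n i := (size (above (teneva_III n i))).+2.

(* h is the arc of the bottom left endpoint. *)
Definition introduces_left n r (c : point -> 'Z_r) i col :=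
  let m := teneva_III n i in let D := target m in
  exists x, [/\ is_new m x,
    (exists l, passes_over D l (bottom_left D) /\ emerges_under D l x),
    enters_left D (crossing_after n i) x & c x = col].

Definition removes_right n r (d : point -> 'Z_r) i col :=
  let m := teneva_III n i in let D := source m in
  exists x, [/\ is_removed m x,
    (exists l, passes_over D l (bottom_left D) /\ arrives_under D l x),
    leaves_right D (crossing_before n i) x & d x = col].

(* Main.v *)
(* Every move fixes the colors of the two top endpoints and of the bottom left
   endpoint, and h always ends there, so h keeps the color (a + n(b - a)) which
   it has in the braid.  Above the kink the diagram is still sigma_1^k, so the
   strands reaching it have the colors a + k(b - a) and a + (k + 1)(b - a).
   The arc introduced is the continuation under h of the left one; the arc
   removed comes from crossing k + 1 of the braid.  Both go from one crossing
   directly to the next as under-arcs, so they do not leave the disc. *)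
Require Import Defs.
From mathcomp Require Import all_boot all_algebra.
From mathcomp Require Import zify ring.
Import GRing.Theory.

(** * Slices and widths of stacked tangles *)

Lemma onth_cat_size T (u v : seq T) j : onth (u ++ v) (size u + j) = onth v j.
Proof. by rewrite onth_cat ltnNge leq_addr /= addKn. Qed.

Lemma width_cat m u v l : width (Diagram m (u ++ v)) (size u + l) =
  width (Diagram (width (Diagram m u) (size u)) v) l.
Proof.
by rewrite /width /= take_size take_cat ltnNge leq_addr /= addKn foldl_cat.
Qed.

Lemma foldl_nseq_cross m k e j :
  foldl (fun m s => width_below s m) m (nseq k (Cross e j)) = m.
Proof. by elim: k. Qed.

Lemma width_nseq_cross m k e j w l : l <= k ->
  width (Diagram m (nseq k (Cross e j) ++ w)) l = m.
Proof.
move=> lk; rewrite /width /= takel_cat ?size_nseq // take_nseq //.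
exact: foldl_nseq_cross.
Qed.

Lemma width_nseq_cross_cat m k e j w l :
  width (Diagram m (nseq k (Cross e j) ++ w)) (k + l) = width (Diagram m w) l.
Proof.
rewrite -{2}(size_nseq k (Cross e j)) width_cat size_nseq.
by rewrite -[nseq _ _]cats0 width_nseq_cross.
Qed.

(** * Vertical strands, and arcs reduced to one point *)

Lemma same_arc_vertical D l p m :
  (forall j, j < m -> p < width D (l + j) /\
     exists2 s, onth (slices D) (l + j) = Some s & through s p p) ->
  0 < m -> same_arc D (l, p) (l + m, p).
Proof.
elim: m => // m IH vert _.
have [lt_p [s Ds thr]] := vert m (ltnSn m).
have step : same_arc D (l + m, p) (l + m.+1, p).
  by rewrite addnS; exact: arc_through Ds lt_p thr.
case: m => [|m] in IH vert step {lt_p s Ds thr} *.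
  by rewrite addn0 in step.
by apply: arc_trans step; apply: IH => // j lt_j; apply: vert; exact: ltnW.
Qed.

(** The strand emerges from under one crossing and at once goes under the next, so no [through] step
    and no extremum joins this point to another one. *)
Lemma same_arc_lone {D l e k e' k'} :
  onth (slices D) l = Some (Cross e k) ->
  onth (slices D) l.+1 = Some (Cross e' k') ->
  under_bot e k = under_top e' k' ->
  forall y, same_arc D (l.+1, under_bot e k) y -> y = (l.+1, under_bot e k).
Proof.
move=> Dl DSl eq_k y; set z := (_, _) => arc_zy.
(* Being equal to [z] is invariant along [same_arc], which allows an induction on the relation. *)
suff E x x' : same_arc D x x' -> (x == z) = (x' == z).
  by apply/eqP; rewrite -(E _ _ arc_zy).
elim=> {y arc_zy x x'} //.
- by move=> x y t _ -> _ ->.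
- move=> j s p q Ds _ thr; rewrite /z !xpair_eqE eqSS.
  (* Only the slices just below and just above [z] could continue a strand through it, and both have
     [z] on their under-strand. *)
  have [jl|_] /= := eqVneq j l.+1.
    move: Ds thr; rewrite jl DSl eq_k => -[<-] /=.
    rewrite (gtn_eqF (ltnSn l)) /=.
    by case: e' {DSl eq_k z} => /=; case: (p =P _) => /=; lia.
  have [jl|//] /= := eqVneq j l; move: Ds thr; rewrite jl Dl => -[<-] /=.
  by case: e {Dl eq_k z} => /=; case: (p =P _) => /=; lia.
- move=> j q Ds; rewrite /z !xpair_eqE eqSS.
  by have [jl|//] := eqVneq j l; rewrite jl Dl in Ds.
- move=> j q Ds; rewrite /z !xpair_eqE.
  by have [jl|//] := eqVneq j l.+1; rewrite jl DSl in Ds.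
Qed.

(** * Colors forced by the crossings *)

Section Colorings.

Local Open Scope ring_scope.

Lemma fox_coloring_under {r D} {c : point -> 'Z_r} {l e k} :
  fox_coloring D c -> onth (slices D) l = Some (Cross e k) ->
  c (l.+1, under_bot e k) = c (l, over_top e k) *+ 2 - c (l, under_top e k).
Proof.
move=> [_ cross] /cross H; apply/eqP; rewrite -subr_eq0 -H; apply/eqP; ring.
Qed.

(** The over-strand carries its color to the left, and the under-strand leaves with twice that color
    minus its own: an arithmetic progression of difference [b - a]. *)
Lemma fox_coloring_nseq {r k w} {c : point -> 'Z_r} {a b : 'Z_r} :
  fox_coloring (Diagram 2 (nseq k (sigma 0) ++ w)) c ->
  c (0, 0)%N = a -> c (0, 1)%N = b -> forall l, (l <= k)%N ->
  c (l, 0)%N = a + (b - a) *+ l /\ c (l, 1)%N = a + (b - a) *+ l.+1.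
Proof.
move=> fox c0 c1; elim=> [|l IH] lt_l.
  by rewrite c0 c1; split; ring.
have [cl0 cl1] := IH (ltnW lt_l).
set D := Diagram _ _ in fox.
have Dl : onth (slices D) l = Some (sigma 0).
  by rewrite /D /= onth_cat size_nseq lt_l onth_nseq lt_l.
split; last by rewrite (fox_coloring_under fox Dl) /= cl0 cl1; ring.
rewrite -cl1; symmetry; apply: fox.1; apply: arc_through Dl _ _ => //.
by rewrite width_nseq_cross // ltnW.
Qed.

(** * The diagrams before and after a type III move *)

(** Common form of both diagrams of a type III move: they differ only in [w]. *)
Definition kinked k w := Diagram 2 (nseq k (sigma 0) ++ Max 2 :: w).

Lemma teneva_III_source_kinked n i : source (teneva_III n i) =
  kinked (n.-1 - i) [:: sigma 0, sigma 1, sigma 0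
                      & nseq i.-1 (sigma 1) ++ [:: Min 2]].
Proof. by rewrite /source /kinked /= -catA. Qed.

Lemma teneva_III_target_kinked n i : (0 < i)%N -> target (teneva_III n i) =
  kinked (n.-1 - i) [:: sigma 1, sigma 0 & nseq i (sigma 1) ++ [:: Min 2]].
Proof. by case: i => // i _; rewrite /target /kinked /= -catA. Qed.

(** With the level written [(j + k).+1], a numeral [j] gives [k.+1], [k.+2], ... by conversion. *)
Lemma onth_kinked k w j : onth (slices (kinked k w)) (j + k).+1 = onth w j.
Proof.
by rewrite -addSn addnC -{2}(size_nseq k (sigma 0)) /= onth_cat_size.
Qed.

Lemma width_kinked k w j :
  width (kinked k w) (j + k).+1 = width (Diagram 4 w) j.
Proof. by rewrite -addSn addnC width_nseq_cross_cat. Qed.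

Lemma kinked_colors {r k w} {c : point -> 'Z_r} {a b : 'Z_r} :
  fox_coloring (kinked k w) c -> c (0, 0)%N = a -> c (0, 1)%N = b ->
  c (k.+1, 0)%N = a + (b - a) *+ k /\ c (k.+1, 1)%N = a + (b - a) *+ k.+1.
Proof.
move=> fox c0 c1; have [<- <-] := fox_coloring_nseq fox c0 c1 k (leqnn k).
have Dk : onth (slices (kinked k w)) k = Some (Max 2).
  by rewrite /= onth_cat size_nseq ltnn subnn.
by split; symmetry; apply: fox.1; apply: arc_through Dk _ _;
  rewrite ?width_nseq_cross.
Qed.

(** The slices below [w] act only to the right of position 0, so the strand there descends
    vertically. *)
Lemma kinked_bottom_arc k w i : width (Diagram 4 w) (size w) = 4 ->
  let D := kinked k (w ++ nseq i (sigma 1) ++ [:: Min 2]) in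
  same_arc D ((size w + k).+1, 0)%N (bottom_left D).
Proof.
move=> w4 D.
have -> : bottom_left D = ((size w + k).+1 + i.+1, 0)%N.
  by congr pair; rewrite /= !size_cat /= !size_cat !size_nseq /=; lia.
apply: same_arc_vertical => // j lt_j.
have -> : ((size w + k).+1 + j)%N = ((size w + j) + k).+1 by lia.
rewrite width_kinked width_cat w4 onth_kinked onth_cat_size.
split; first by rewrite width_nseq_cross.
rewrite onth_cat size_nseq onth_nseq; case: ltnP => le_j.
  by exists (sigma 1).
by have -> : j = i; [lia|rewrite subnn; exists (Min 2)].
Qed.

(** * Endpoint colors along the sequence of moves *)

Definition endpoint_colors {r} D (c : point -> 'Z_r) (a b t : 'Z_r) :=
  [/\ c (0, 0)%N = a, c (0, 1)%N = b & c (bottom_left D) = t].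

(** The top and bottom levels are never inside the modified block; the width hypotheses make the
    bottom left point exist in both diagrams. *)
Lemma recolors_endpoints {r m} {c c' : point -> 'Z_r} {a b t} :
  recolors m c c' -> (1 < strands m)%N ->
  (0 < width (source m) (size (slices (source m))))%N ->
  (0 < width (target m) (size (slices (target m))))%N ->
  endpoint_colors (source m) c a b t -> endpoint_colors (target m) c' a b t.
Proof.
move=> [_ _ same] m1 ws wt [<- <- <-].
split; apply: same; split; rewrite /on ?leqnn //=; try by left.
- by rewrite /width take0 /= ltnW.
- by rewrite /width take0 /= ltnW.
- by rewrite /width take0.
- by rewrite /width take0.
by right; exists (size (below m)); rewrite !size_cat !addnA.
Qed.

Section Teneva.

Variables (n r : nat) (a b : 'Z_r) (cB cI : point -> 'Z_r).
Variables (d c : nat -> point -> 'Z_r).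
Hypotheses (n1 : (1 < n)%N) (hT : teneva_coloring n a b cB cI d c).

Let t : 'Z_r := a + (b - a) *+ n.

Local Ltac bottom := by rewrite /width take_size /source /target /=
  ?(foldl_cat, foldl_nseq_cross) //= ?(foldl_cat, foldl_nseq_cross).

Lemma teneva_endpoints_0 :
  endpoint_colors (target (teneva_I_isotopy n)) (c 0%N) a b t.
Proof.
have [c0 c1] := teneva_top hT.
apply: (recolors_endpoints (teneva_recolors_I_isotopy hT)) => //; try bottom.
rewrite teneva_I_isotopy_source.
apply: (recolors_endpoints (teneva_recolors_I hT)) => //; try bottom.
rewrite teneva_I_source; last exact: ltnW.
split=> //; rewrite /bottom_left size_nseq.
have := teneva_braid hT; rewrite /braid -[nseq _ _]cats0 => fox.
by case: (fox_coloring_nseq fox c0 c1 n).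
Qed.

Lemma teneva_endpoints_III i : (0 < i <= n.-1)%N ->
  endpoint_colors (source (teneva_III n i)) (d i) a b t /\
  endpoint_colors (target (teneva_III n i)) (c i) a b t.
Proof.
elim: i => // i IH hi.
have src : endpoint_colors (source (teneva_III n i.+1)) (d i.+1) a b t.
  rewrite teneva_III_source.
  apply: (recolors_endpoints (teneva_recolors_III_isotopy hT hi)) => //;
    try bottom.
  (* The first isotopy starts from the type I stage, each later one from the preceding type III
     move. *)
  case: i IH hi => [|i] IH hi.
    by rewrite teneva_III_isotopy_source1 //; exact: teneva_endpoints_0.
  by rewrite teneva_III_isotopy_sourceS; [apply: (IH _).2|]; lia.
split=> //.
by apply: (recolors_endpoints (teneva_recolors_III hT hi)) => //; bottom.
Qed.

(** * The arcs introduced and removed by a type III move *)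

(** Passing under h turns [a + k(b - a)] into [2t - (a + k(b - a))], which is
    [a + (n + i + 1)(b - a)] since [n = k + i + 1]. *)
Lemma teneva_introduces_left i : (0 < i <= n.-1)%N ->
  introduces_left n (c i) i (b *+ (n + 1 + i) - a *+ (n + i)).
Proof.
move=> hi; have /andP[i0 i_le] := hi.
have [_ [c0 c1 ch]] := teneva_endpoints_III i hi.
have [_ fox _] := teneva_recolors_III hT hi.
rewrite /introduces_left.
set k := (n.-1 - i)%N.
have crossingE : crossing_after n i = k.+3.
  by rewrite /crossing_after size_cat size_nseq addn1.
(* There are [k + 1] slices above the block of three, so outside points have level at most [k + 1]
   or at least [k + 4]. *)
have fresh y y' : outside (teneva_III n i) y y' -> y'.1 <> k.+3.
  case=> _ _ _; rewrite /= size_cat size_nseq /= => h e.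
  by case: h => [|[j]]; lia.
rewrite {}crossingE teneva_III_target_kinked // -/k in ch fox *.
move: fox ch; set w := [:: _, _ & _]; set D := kinked _ w => fox ch.
have D0 : onth (slices D) k.+1 = Some (sigma 1) := onth_kinked k w 0.
have D1 : onth (slices D) k.+2 = Some (sigma 0) := onth_kinked k w 1.
have D2 : onth (slices D) k.+3 = Some (sigma 1).
  by rewrite (onth_kinked k w 2) /w; case: (i) i0.
have w1 : width D k.+1 = 4 := width_kinked k w 0.
have w2 : width D k.+2 = 4 := width_kinked k w 1.
have w3 : width D k.+3 = 4.
  by rewrite (width_kinked k w 2) /width /= take0.
have h_arc : same_arc D (k.+2, 1)%N (bottom_left D).
  apply: (arc_trans (y := (k.+3, 0)%N)); first by
    apply: arc_through D1 _ _; rewrite ?w2.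
  exact: (kinked_bottom_arc k [:: sigma 1; sigma 0] i).
have on_x : on D (k.+3, 1)%N.
  by rewrite /on w3 /= andbT !size_cat size_nseq /= size_cat size_nseq /=; lia.
have xx := arc_refl on_x.
(* The left strand emerges here from under h, whose second crossing is the [sigma 0] at level
   [k + 2], and enters crossing [n - i] just below. *)
exists (k.+3, 1)%N; split.
- rewrite /is_new teneva_III_target_kinked //; split=> // y y' /fresh y'1.
  by move/(same_arc_lone D1 D2 erefl) => y'E; rewrite y'E in y'1.
- by exists k.+2; split; exists true, 0%N.
- by exists true, 1%N.
rewrite (fox_coloring_under fox D1) /= (fox.1 _ _ h_arc) ch.
have <- : c i (k.+1, 0)%N = c i (k.+2, 0)%N.
  by apply: fox.1; apply: arc_through D0 _ _; rewrite ?w1.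
rewrite (kinked_colors fox c0 c1).1 /t.
have -> : n = (k + i).+1 by rewrite /k; lia.
ring.
Qed.

(** The color comes from crossing [n - i = k + 1] of the braid alone:
    [2(a + (k + 1)(b - a)) - (a + k(b - a))]. *)
Lemma teneva_removes_right i : (1 < i <= n.-1)%N ->
  removes_right n (d i) i (b *+ (n + 1 - i) - a *+ (n - i)).
Proof.
move=> hi'; have hi : (0 < i <= n.-1)%N by lia.
have [[c0 c1 _] _] := teneva_endpoints_III i hi.
have [fox _ _] := teneva_recolors_III hT hi.
rewrite /removes_right.
set k := (n.-1 - i)%N.
have crossingE : crossing_before n i = k.+1.
  by rewrite /crossing_before size_cat size_nseq addn1.
have gone y y' : outside (teneva_III n i) y y' -> y.1 <> k.+2.
  case=> _ _ _; rewrite /= size_cat size_nseq /= => h e.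
  by case: h => [|[j]]; lia.
rewrite {}crossingE teneva_III_source_kinked -/k in fox *.
move: fox; set w := [:: _, _, _ & _]; set D := kinked _ w => fox.
have D0 : onth (slices D) k.+1 = Some (sigma 0) := onth_kinked k w 0.
have D1 : onth (slices D) k.+2 = Some (sigma 1) := onth_kinked k w 1.
have D2 : onth (slices D) k.+3 = Some (sigma 0) := onth_kinked k w 2.
have w2 : width D k.+2 = 4 := width_kinked k w 1.
have w3 : width D k.+3 = 4 := width_kinked k w 2.
(* Before the move, h passes over in the [sigma 1] and then the [sigma 0] that follow crossing
   [n - i]. *)
have h_arc : same_arc D (k.+2, 2)%N (bottom_left D).
  apply: (arc_trans (y := (k.+3, 1)%N)); first by
    apply: arc_through D1 _ _; rewrite ?w2.
  apply: (arc_trans (y := (k.+4, 0)%N)); first by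
    apply: arc_through D2 _ _; rewrite ?w3.
  exact: (kinked_bottom_arc k [:: sigma 0; sigma 1; sigma 0] i.-1).
have on_x : on D (k.+2, 1)%N.
  by rewrite /on w2 /= andbT !size_cat size_nseq /= size_cat size_nseq /=; lia.
have xx := arc_refl on_x.
(* The lower right end of crossing [n - i], which the next slice takes under h. *)
exists (k.+2, 1)%N; split.
- rewrite /is_removed teneva_III_source_kinked; split=> // y y' /gone y1.
  by move/(same_arc_lone D0 D1 erefl) => yE; rewrite yE in y1.
- by exists k.+2; split; exists true, 1%N.
- by exists true, 0%N.
have [ck0 ck1] := kinked_colors fox c0 c1.
rewrite (fox_coloring_under fox D0) /= ck0 ck1.
have -> : (n + 1 - i)%N = k.+2 by rewrite /k; lia.
have -> : (n - i)%N = k.+1 by rewrite /k; lia.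
ring.
Qed.

End Teneva.

End Colorings.

Theorem lemma3p1 (n r : nat) (a b : 'Z_r) (cB cI : point -> 'Z_r)
    (d c : nat -> point -> 'Z_r) (hn : 3 <= n) (hr : 2 <= r)
    (hT : teneva_coloring n a b cB cI d c) :
  introduces_left n (c 1) 1 (b *+ (n + 2) - a *+ (n + 1))%R /\
  (forall i : nat, 2 <= i <= n - 1 ->
     removes_right n (d i) i (b *+ (n + 1 - i) - a *+ (n - i))%R /\
     introduces_left n (c i) i (b *+ (n + 1 + i) - a *+ (n + i))%R).
Proof.
have n1 := ltnW hn.
have intro := teneva_introduces_left n r a b cB cI d c n1 hT.
split=> [|i hi].
  (* Puts [n + 2] in the form [n + 1 + i] with [i = 1]. *)
  by rewrite -[2]/(1 + 1) addnA; apply: intro; lia.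
split; last by apply: intro; lia.
by apply: (teneva_removes_right n r a b cB cI d c n1 hT); lia.
Qed.
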